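(* Let $A$ be a $(0,1,\ast)$-matrix with $n$ columns and column min-rank $r$. Then $\mathrm{opt}(A)\leq 2^{n-r}$.
   Context: A $(0,1,\ast)$-matrix is a matrix with entries in $\{0,1,\ast\}$; all arithmetic is over $GF_2$. A completion of $A$ is a $(0,1)$-matrix obtained from $A$ by replacing each $\ast$ by $0$ or $1$. For an $m$-by-$n$ $(0,1,\ast)$-matrix $A=(a_{ij})$, an operator $G=(g_1,\dots,g_m):\{0,1\}^n\to\{0,1\}^m$ is consistent with $A$ if each $g_i$ depends only on the variables $x_j$ with $a_{ij}=\ast$. A set $L\subseteq\{0,1\}^n$ is a solution for $A$ if there exist a completion $M$ of $A$ and an operator $G$ consistent with $A$ such that $M\mathbf{x}=G(\mathbf{x})$ for all $\mathbf{x}\in L$; $\mathrm{opt}(A)$ is the maximum size of a solution for $A$. A collection of $(0,1,\ast)$-vectors is dependent if its $\ast$-entries can be set to constants $0,1$ so that the resulting $(0,1)$-vectors are linearly dependent over $GF_2$; otherwise it is independent. The column min-rank of $A$ is the maximum number of independent columns of $A$. *)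

(* Defs.v *)
From HB Require Import structures.
From mathcomp Require Import all_boot all_order all_algebra.

Set Implicit Arguments.
Unset Strict Implicit.
Unset Printing Implicit Defensive.

Import GRing.Theory.
Local Open Scope ring_scope.

(* Matrix entries: [Some b] is the constant b, [None] is the star entry. *)
Notation star_entry := (option 'F_2).

Definition completion (m n : nat) (A : 'M[star_entry]_(m, n))
    (M : 'M['F_2]_(m, n)) : bool :=
  [forall i, forall j, (A i j != None) ==> (A i j == Some (M i j))].

(* "g_i depends only on the x_j with a star at a_ij": g_i takes equal values at any
   two points that agree on those coordinates. *)
Definition consistent (m n : nat) (A : 'M[star_entry]_(m, n))
    (G : {ffun 'cV['F_2]_n -> 'cV['F_2]_m}) : bool :=
  [forall i, forall x : 'cV['F_2]_n, forall y : 'cV['F_2]_n,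
     [forall j, (A i j == None) ==> (x j 0 == y j 0)]
       ==> (G x i 0 == G y i 0)].

Definition solution (m n : nat) (A : 'M[star_entry]_(m, n))
    (L : {set 'cV['F_2]_n}) : bool :=
  [exists M : 'M['F_2]_(m, n), exists G : {ffun 'cV['F_2]_n -> 'cV['F_2]_m},
     [&& completion A M, consistent A G & [forall x in L, M *m x == G x]]].

Definition opt (m n : nat) (A : 'M[star_entry]_(m, n)) : nat :=
  (\max_(L : {set 'cV['F_2]_n} | solution A L) #|L|)%N.

(* Collections are families: repeated vectors count as dependent. *)
Definition dependent (m k : nat) (v : k.-tuple 'cV[star_entry]_m) : bool :=
  [exists w : k.-tuple 'cV['F_2]_m,
     [forall i, completion (tnth v i) (tnth w i)] && ~~ free w].

Definition independent (m k : nat) (v : k.-tuple 'cV[star_entry]_m) : bool :=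
  ~~ dependent v.

Definition columns (m n : nat) (A : 'M[star_entry]_(m, n)) (S : {set 'I_n}) :
    #|S|.-tuple 'cV[star_entry]_m :=
  [tuple col (enum_val i) A | i < #|S|].

Definition col_minrank (m n : nat) (A : 'M[star_entry]_(m, n)) : nat :=
  (\max_(S : {set 'I_n} | independent (columns A S)) #|S|)%N.

(* Main.v *)
Require Import Defs.
From mathcomp Require Import all_boot all_order all_algebra.

Import GRing.Theory.

(** Fix an independent set [S] of [r] columns, a solution [L], and two points
    of [L] that agree outside [S]; let [d] be their difference, so [d] is
    supported in [S].  If a row has no star on the support of [d], consistency
    gives [(M d)_i = 0]; otherwise flipping one such star entry of [M] makes
    [(M d)_i = 0].  The resulting completion kills [d], so independence forces
    [d = 0].  Hence restriction to the coordinates outside [S] is injective on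
    [L], and [#|L| <= 2 ^ (n - r)]. *)

Local Open Scope ring_scope.

Lemma completionP {m n : nat} {A : 'M[star_entry]_(m, n)} {M : 'M['F_2]_(m, n)} :
  reflect (forall i j, A i j != None -> A i j = Some (M i j)) (completion A M).
Proof.
apply: (iffP forallP) => [cM i j Aij | cM i].
  by have /forallP/(_ j)/implyP/(_ Aij)/eqP := cM i.
by apply/forallP => j; apply/implyP => /cM ->.
Qed.

(** The columns of [N] indexed by [S] complete independent columns, so they are free. As [d]
    vanishes off [S], [N *m d = 0] is a linear relation among them whose coefficients are entries of
    [d]. *)
Lemma independent_completion_kernel {m n : nat} {A : 'M[star_entry]_(m, n)}
    {S : {set 'I_n}} {N : 'M['F_2]_(m, n)} {d : 'cV['F_2]_n} :
  independent (columns A S) -> completion A N ->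
  (forall j, j \notin S -> d j 0 = 0) -> N *m d = 0 -> d = 0.
Proof.
move=> indS /completionP cN dS Nd0.
have fS : free [tuple col (enum_val i) N | i < #|S|].
  apply: contraNT indS => nfree; apply/existsP.
  exists [tuple col (enum_val i) N | i < #|S|]; rewrite nfree andbT.
  apply/forallP => k; apply/completionP => i j.
  by rewrite !tnth_mktuple !mxE => /cN.
have dS0 : forall k : 'I_#|S|, d (enum_val k) 0 = 0.
  move/freeP: fS => /(_ (fun k => d (enum_val k) 0)); apply.
  rewrite -[RHS]Nd0; apply/matrixP => i l; rewrite ord1 summxE mxE.
  rewrite [RHS](bigID (mem S)) [RHS]/= [X in _ + X]big1 ?addr0; last first.
    by move=> j /dS ->; rewrite mulr0.
  rewrite [RHS]big_enum_val; apply: eq_bigr => k _.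
  by rewrite -tnth_nth tnth_mktuple !mxE mulrC.
apply/matrixP => j l; rewrite ord1 mxE.
have [jS | /dS //] := boolP (j \in S).
by rewrite -(enum_rankK_in jS jS) dS0.
Qed.

Lemma F2_neq0 (a : 'F_2) : a != 0 -> a = 1.
Proof. by case: a => [[|[|//]] ?] // _; apply/val_inj. Qed.

Lemma completion_kill {m n : nat} {A : 'M[star_entry]_(m, n)}
    {M : 'M['F_2]_(m, n)} {d : 'cV['F_2]_n} :
  completion A M ->
  (forall i, (forall j, A i j = None -> d j 0 = 0) -> (M *m d) i 0 = 0) ->
  exists2 N, completion A N & N *m d = 0.
Proof.
move=> /completionP cM Md0.
(* [star i] picks a star of row [i] on the support of [d], if any, and [E] places [(M *m d) i 0]
   there. So [M - E] alters only stars, and [E *m d = M *m d] since [d] is 1 at each chosen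
   entry. *)
pose star i := [pick j | (A i j == None) && (d j 0 != 0)].
pose E := \matrix_(i, j) (if star i == Some j then (M *m d) i 0 else 0).
exists (M - E).
  apply/completionP => i j Aij; rewrite (cM _ _ Aij) !mxE /star.
  case: pickP => [j0 /andP[/eqP Aj0 _]|_] /=; last by rewrite subr0.
  by case: eqP => [[j0j]|_]; [rewrite -j0j Aj0 in Aij | rewrite subr0].
apply/matrixP => i l; rewrite ord1 mulmxBl [RHS]mxE mxE [X in _ + X]mxE.
rewrite [X in _ - X]mxE.
case def_s: (star i) => [j0|]; last first.
  rewrite big1 ?subr0 => [|j _]; last by rewrite mxE def_s mul0r.
  apply: Md0 => j Aij; move: def_s; rewrite /star; case: pickP => // /(_ j).
  by rewrite Aij eqxx => /negbFE/eqP.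
have dj0 : d j0 0 = 1.
  move: def_s; rewrite /star; case: pickP => // j /andP[_ dj] [<-].
  exact: F2_neq0.
rewrite (bigD1 j0) //= big1 ?addr0; last first.
  by move=> j nj; rewrite mxE def_s (inj_eq Some_inj) eq_sym (negPf nj) mul0r.
by rewrite [E _ _]mxE def_s eqxx dj0 mulr1 subrr.
Qed.

Lemma solution_restriction_inj {m n : nat} {A : 'M[star_entry]_(m, n)}
    {S : {set 'I_n}} {L : {set 'cV['F_2]_n}} {x y : 'cV['F_2]_n} :
  independent (columns A S) -> solution A L -> x \in L -> y \in L ->
  (forall j, j \notin S -> x j 0 = y j 0) -> x = y.
Proof.
move=> indS /existsP[M /existsP[G /and3P[cM cG /forall_inP MG]]] xL yL xyS.
have [|N cN Nd] := @completion_kill _ _ _ _ (x - y) cM.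
  (* With no star of row [i] on the support of [x - y], the two points agree on every variable that
     row [i] of [G] may read. *)
  move=> i di; rewrite mulmxBr (eqP (MG x xL)) (eqP (MG y yL)) !mxE.
  apply/eqP; rewrite subr_eq0.
  move/forallP/(_ i)/forallP/(_ x)/forallP/(_ y)/implyP: cG; apply.
  apply/forallP => j; apply/implyP => /eqP /di.
  by rewrite !mxE => /eqP; rewrite subr_eq0.
apply/eqP; rewrite -subr_eq0; apply/eqP.
apply: independent_completion_kernel indS cN _ Nd => j /xyS.
by rewrite !mxE => ->; rewrite subrr.
Qed.

Lemma card_solution_le {m n : nat} {A : 'M[star_entry]_(m, n)}
    {S : {set 'I_n}} {L : {set 'cV['F_2]_n}} :
  independent (columns A S) -> solution A L -> (#|L| <= 2 ^ (n - #|S|))%N.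
Proof.
move=> indS solL.
pose f (x : 'cV['F_2]_n) : 'cV['F_2]_#|~: S| := rowsub enum_val x.
have f_inj : {in L &, injective f}.
  move=> x y xL yL /matrixP fxy.
  apply: solution_restriction_inj indS solL xL yL _ => j.
  rewrite -in_setC => jS.
  by have := fxy (enum_rank_in jS j) 0; rewrite !mxE enum_rankK_in.
rewrite -(card_in_imset f_inj); apply: leq_trans (max_card _) _.
by rewrite card_mx card_Fp // muln1 cardsCs setCK card_ord.
Qed.

Local Close Scope ring_scope.

Theorem theorem1 (m n r : nat) (A : 'M[star_entry]_(m, n))
    (hr : col_minrank A = r) :
  opt A <= 2 ^ (n - r).
Proof.
(* The empty family is independent, so the maximum in [col_minrank] has a nonempty range and is
   attained by some [S]. *)
have ind0 : independent (columns A set0).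
  apply/negP => /existsP[w /andP[_]] /negP; apply; apply/freeP => k _ i.
  by have := ltn_ord i; rewrite [X in _ < X]cards0.
apply/bigmax_leqP => L solL; rewrite -hr /col_minrank.
have [|S indS ->] := @eq_bigmax_cond _ [pred S | independent (columns A S)]
  (fun S => #|S|); first by apply/card_gt0P; exists set0.
exact: card_solution_le indS solL.
Qed.
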